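(* Let $X=\mathbb{Z}_2^3\ltimes Cl_3$ be the order 128 non-Abelian group with generators $\pm e_i,g_i$, $i=1,2,3$ (where $-1$ is central with $(-1)^2=1$) and relations $$e_ie_j=\begin{cases}-e_je_i & i\ne j\\ -1 & i=j\end{cases},\qquad e_ig_j=\begin{cases}g_je_i & i\neq j\\ -g_je_i & i=j\end{cases},\qquad g_ig_j=g_jg_i,\qquad g_i^2=1,$$ and let $G=\mathbb{Z}_2^3$ be the subgroup generated by $g_1,g_2,g_3$. Let $M\subset X$ be the set $\{\pm e_{\vec a}\mid \vec a\in\mathbb{Z}_2^3\}$, where $$e_{000}=1,\quad e_{001}=e_3,\quad e_{010}=e_2,\quad e_{011}=-g_1e_2e_3,$$ $$e_{100}=e_1,\quad e_{101}=-g_2e_1e_3,\quad e_{110}=-g_3e_1e_2,\quad e_{111}=g_1g_2g_3e_1e_2e_3.$$ Then $M$ is a transversal of $G$ in $X$ (every $x\in X$ lies in $Gs$ for a unique $s\in M$), and with the induced product $\cdot$ on $M$ it acquires the structure of the octonion quasigroup $G_{\mathbb{O}}$, i.e. $(\sigma e_{\vec a})\cdot(\rho e_{\vec b})=\sigma\rho F(\vec a,\vec b)e_{\vec a+\vec b}$ for all signs $\sigma,\rho\in\{\pm1\}$ and $\vec a,\vec b\in\mathbb{Z}_2^3$. Moreover, every element of $M$ has a right inverse in $(M,\cdot)$, $(M,\cdot)$ is an inverse property quasigroup, the identity $$\tau(s\triangleleft(t\triangleright u),\,t\triangleleft u)=(s\triangleright(t\triangleright u))^{-1}\,\tau(s,t)\,(s\triangleright(t\triangleright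 u))$$ holds for all $s,t\in M$, $u\in G$, and hence, for any field $k$, the bicrossproduct of $kM=kG_{\mathbb{O}}$ and $k(G)=k(\mathbb{Z}_2^3)$ is a Hopf quasigroup $kG_{\mathbb{O}}>\!\!\!\blacktriangleleft k(\mathbb{Z}_2^3)$.
   Context: Octonion quasigroup $G_{\mathbb{O}}$: the set of 16 elements $\{\pm e_{\vec a}\mid\vec a\in\mathbb{Z}_2^3\}$, with product $e_{\vec a}\cdot e_{\vec b}=F(\vec a,\vec b)e_{\vec a+\vec b}$ extended to signs in the obvious way, where $\vec a+\vec b$ is componentwise addition mod 2 and $F(\vec a,\vec b)\in\{\pm1\}$ is the entry in row $\vec a$, column $\vec b$ (both in binary order $000,001,010,011,100,101,110,111$) of $$\left(\begin{array}{cccccccc} 1 & 1 & 1 & 1 & 1 & 1 & 1 & 1 \\ 1 & -1 & 1 & -1 & 1 & -1 & 1 & -1 \\ 1 & -1 & -1 & 1 & 1 & -1 & -1 & 1 \\ 1 & 1 & -1 & -1 & -1 & -1 & 1 & 1 \\ 1 & -1 & -1 & 1 & -1 & 1 & 1 & -1 \\ 1 & 1 & 1 & 1 & -1 & -1 & -1 & -1 \\ 1 & -1 & 1 & -1 & -1 & 1 & -1 & 1 \\ 1 & 1 & -1 & -1 & 1 & 1 & -1 & -1 \end{array}\right).$$ $Cl_3$ is the order 16 group generated by $\pm e_1,\pm e_2,\pm e_3$. Induced maps: given a transversal $M\ni e$ of $G$ in $X$ (here $e=1$ denotes the identity of $X$), every element of $X$ is uniquely $us$ with $u\in G$, $s\in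 M$, and the maps $\tau:M\times M\to G$, $\cdot:M\times M\to M$, $\triangleright:M\times G\to G$, $\triangleleft:M\times G\to M$ are defined by $st=\tau(s,t)(s\cdot t)$ and $su=(s\triangleright u)(s\triangleleft u)$ (products in $X$). A right inverse of $s$ in $(M,\cdot)$ is $s^{-R}\in M$ with $s\cdot s^{-R}=e$. (Inverse property) quasigroup: a set with a product, a two-sided identity $e$, and for each $s$ an element $s^{-1}$ such that $s^{-1}(st)=t=(ts)s^{-1}$ for all $t$. Bicrossproduct of $kM$ and $k(G)$: the $k$-vector space with basis $\{s\otimes\delta_u\mid s\in M,u\in G\}$, with $$(s\otimes\delta_u)(t\otimes\delta_v)=\delta_{u,t\triangleright v}\,(s\cdot t\otimes\delta_v),\qquad 1=\sum_{u\in G}e\otimes\delta_u,$$ $$\Delta(s\otimes\delta_u)=\sum_{a,b\in G,\ ab=u}(s\otimes\delta_a)\otimes(s\triangleleft a\otimes\delta_b),\qquad \varepsilon(s\otimes\delta_u)=\delta_{u,e}.$$ The notation $>\!\!\!\blacktriangleleft$ is used for it when $\triangleright$ is trivial, i.e. $s\triangleright u=u$ for all $s,u$, as is the case here. It is a Hopf quasigroup if an antipode $S$ as below exists. Hopf quasigroup: a possibly nonassociative unital $k$-algebra $H$ with algebra homomorphisms $\Delta:H\to H\otimes H$, $\varepsilon:H\to k$ forming a coassociative counital coalgebra, and a linear map $S:H\to H$ such that, writing $\Delta h=\sum h_{(1)}\otimes h_{(2)}$, for all $h,g\in H$ $$\sum S(h_{(1)})(h_{(2)}g)=\sum h_{(1)}(S(h_{(2)})g)=\sum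 (g\,S(h_{(1)}))h_{(2)}=\sum (g h_{(1)})S(h_{(2)})=\varepsilon(h)g.$$ *)

(* Defs.v *)
From HB Require Import structures.
From mathcomp Require Import all_boot all_algebra all_fingroup all_solvable.

Set Implicit Arguments.
Unset Strict Implicit.
Unset Printing Implicit Defensive.

Import GroupScope GRing.Theory.

(* The index i = 1, 2, 3 is shifted to 'I_3 = {0, 1, 2}, so that e_1, e_2, e_3
   are e 0, e 1, e 2; z stands for the central element -1, and negation is
   left multiplication by z. *)
Record X_relations (gT : groupType) (z : gT) (e g : 'I_3 -> gT) : Prop := {
  X_zz : z * z = 1;
  X_ze : forall i, z * e i = e i * z;
  X_zg : forall i, z * g i = g i * z;
  X_ee : forall i j, i != j -> e i * e j = z * (e j * e i);
  X_e2 : forall i, e i * e i = z;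
  X_eg : forall i j, i != j -> e i * g j = g j * e i;
  X_eg_diag : forall i, e i * g i = z * (g i * e i);
  X_gg : forall i j, g i * g j = g j * g i;
  X_g2 : forall i, g i * g i = 1
}.

(* gT is the group with these generators and relations: the generators generate
   it, and it maps to every (possibly infinite) group satisfying the relations. *)
Record X_presentation (gT : finGroupType) (z : gT) (e g : 'I_3 -> gT) : Prop := {
  X_rel : X_relations z e g;
  X_gen : <<z |: [set e i | i : 'I_3] :|: [set g i | i : 'I_3]>> = [set: gT];
  X_univ : forall (hT : groupType) (z' : hT) (e' g' : 'I_3 -> hT),
    X_relations z' e' g' ->
    exists f : gT -> hT,
      [/\ {morph f : x y / x * y}, f z = z', forall i, f (e i) = e' i
        & forall i, f (g i) = g' i]
}.

Definition Gsub (gT : finGroupType) (g : 'I_3 -> gT) : {group gT} :=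
  <<[set g i | i : 'I_3]>>%G.

Definition Cl3 (gT : finGroupType) (z : gT) (e : 'I_3 -> gT) : {group gT} :=
  <<[set e i | i : 'I_3] :|: [set (z * e i)%g | i : 'I_3]>>%G.

Notation Z2_3 := 'rV['Z_2]_3.

(* Position of a in the order 000, 001, 010, 011, 100, 101, 110, 111. *)
Definition binary (a : Z2_3) : nat :=
  (4 * a ord0 0%R + 2 * a ord0 1%R + a ord0 2%:R%R)%N.

Definition evec (gT : groupType) (z : gT) (e g : 'I_3 -> gT) (a : Z2_3) : gT :=
  let e1 := e 0%R in let e2 := e 1%R in let e3 := e 2%:R%R in
  let g1 := g 0%R in let g2 := g 1%R in let g3 := g 2%:R%R in
  nth 1 [:: 1; e3; e2; z * g1 * e2 * e3;
            e1; z * g2 * e1 * e3; z * g3 * e1 * e2;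
            g1 * g2 * g3 * e1 * e2 * e3] (binary a).

Local Open Scope ring_scope.

Definition F (a b : Z2_3) : int :=
  nth 0 (nth [::] [::
    [:: 1;  1;  1;  1;  1;  1;  1;  1];
    [:: 1; -1;  1; -1;  1; -1;  1; -1];
    [:: 1; -1; -1;  1;  1; -1; -1;  1];
    [:: 1;  1; -1; -1; -1; -1;  1;  1];
    [:: 1; -1; -1;  1; -1;  1;  1; -1];
    [:: 1;  1;  1;  1; -1; -1; -1; -1];
    [:: 1; -1;  1; -1; -1;  1; -1;  1];
    [:: 1;  1; -1; -1;  1;  1; -1; -1]] (binary a)) (binary b).

(* The element (s, a) of the octonion quasigroup is (-1)^s e_a. *)
Definition octonion : finType := (bool * Z2_3)%type.

Definition octonion_mul (x y : octonion) : octonion :=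
  (x.1 (+) y.1 (+) (F x.2 y.2 == -1), x.2 + y.2).

Local Close Scope ring_scope.

Definition signed_evec (gT : groupType) (z : gT) (e g : 'I_3 -> gT)
    (x : octonion) : gT :=
  z ^+ x.1 * evec z e g x.2.

Definition Mset (gT : finGroupType) (z : gT) (e g : 'I_3 -> gT) : {set gT} :=
  [set signed_evec z e g x | x : octonion].

Definition transversal_of (gT : finGroupType) (G M : {set gT}) : Prop :=
  forall x : gT, exists! s, s \in M /\ x \in G :* s.

(* When M is a transversal of G, x = Gpart G M x * Mpart G M x is the unique
   factorization of x as an element of G times an element of M. *)
Definition Gpart (gT : finGroupType) (G M : {set gT}) (x : gT) : gT :=
  odflt 1 [pick u in G | u^-1 * x \in M].

Definition Mpart (gT : finGroupType) (G M : {set gT}) (x : gT) : gT :=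
  (Gpart G M x)^-1 * x.

Definition tau (gT : finGroupType) (G M : {set gT}) (s t : gT) : gT :=
  Gpart G M (s * t).

Definition dot (gT : finGroupType) (G M : {set gT}) (s t : gT) : gT :=
  Mpart G M (s * t).

(* s |> u is ltri G M s u and s <| u is rtri G M s u. *)
Definition ltri (gT : finGroupType) (G M : {set gT}) (s u : gT) : gT :=
  Gpart G M (s * u).

Definition rtri (gT : finGroupType) (G M : {set gT}) (s u : gT) : gT :=
  Mpart G M (s * u).

Record ip_quasigroup (T : finType) (M : {set T}) (op : T -> T -> T) (e : T) :
  Prop := {
  ipq_id : e \in M;
  ipq_closed : {in M &, forall s t, op s t \in M};
  ipq_idl : {in M, forall s, op e s = s};
  ipq_idr : {in M, forall s, op s e = s};
  ipq_inv : {in M, forall s, exists2 s', s' \in M &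
    {in M, forall t, op s' (op s t) = t /\ op (op t s) s' = t}}
}.

Local Open Scope ring_scope.

(* {ffun B -> k^o} is the k-vector space with basis B; the tensor product of the
   spaces with bases A and B is the space with basis A * B. *)

Definition delta (k : fieldType) (B : finType) (b : B) : {ffun B -> k^o} :=
  [ffun c => (c == b)%:R].

Definition tens (k : fieldType) (A B : finType) (f : {ffun A -> k^o})
    (g : {ffun B -> k^o}) : {ffun A * B -> k^o} :=
  [ffun p => f p.1 * g p.2].

(* The linear map on the tensor product induced by a bilinear map phi: it sends
   a sum of pure tensors x (x) y to the sum of the phi x y. *)
Definition tlift (k : fieldType) (A B : finType) (V : lmodType k)
    (phi : {ffun A -> k^o} -> {ffun B -> k^o} -> V) (t : {ffun A * B -> k^o}) : V :=
  \sum_(p : A * B) t p *: phi (delta k p.1) (delta k p.2).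

Definition tmul (k : fieldType) (B : finType)
    (mul : {ffun B -> k^o} -> {ffun B -> k^o} -> {ffun B -> k^o})
    (t t' : {ffun B * B -> k^o}) : {ffun B * B -> k^o} :=
  tlift (fun a b => tlift (fun c d => tens (mul a c) (mul b d)) t') t.

Record hopf_quasigroup_axioms (k : fieldType) (B : finType)
    (mul : {ffun B -> k^o} -> {ffun B -> k^o} -> {ffun B -> k^o})
    (one : {ffun B -> k^o})
    (Delta : {ffun B -> k^o} -> {ffun B * B -> k^o})
    (eps : {ffun B -> k^o} -> k^o)
    (S : {ffun B -> k^o} -> {ffun B -> k^o}) : Prop := {
  hq_mul_linear_l : forall g, linear (mul^~ g);
  hq_mul_linear_r : forall h, linear (mul h);
  hq_mul1l : forall h, mul one h = h;
  hq_mul1r : forall h, mul h one = h;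
  hq_Delta_linear : linear Delta;
  hq_Delta1 : Delta one = tens one one;
  hq_DeltaM : forall h g, Delta (mul h g) = tmul mul (Delta h) (Delta g);
  hq_eps_linear : linear eps;
  hq_eps1 : eps one = 1;
  hq_epsM : forall h g, eps (mul h g) = eps h * eps g;
  (* (Delta (x) id) Delta = (id (x) Delta) Delta, up to reassociation *)
  hq_coassoc : forall h a b c,
    tlift (fun x y => tens (Delta x) y) (Delta h) ((a, b), c) =
    tlift (fun x y => tens x (Delta y)) (Delta h) (a, (b, c));
  hq_counitl : forall h, tlift (fun x y => eps x *: y) (Delta h) = h;
  hq_counitr : forall h, tlift (fun x y => eps y *: x) (Delta h) = h;
  hq_S_linear : linear S;
  hq_antipode1 : forall h g,
    tlift (fun x y => mul (S x) (mul y g)) (Delta h) = eps h *: g;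
  hq_antipode2 : forall h g,
    tlift (fun x y => mul x (mul (S y) g)) (Delta h) = eps h *: g;
  hq_antipode3 : forall h g,
    tlift (fun x y => mul (mul g (S x)) y) (Delta h) = eps h *: g;
  hq_antipode4 : forall h g,
    tlift (fun x y => mul (mul g x) (S y)) (Delta h) = eps h *: g
}.

Definition hopf_quasigroup (k : fieldType) (B : finType)
    (mul : {ffun B -> k^o} -> {ffun B -> k^o} -> {ffun B -> k^o})
    (one : {ffun B -> k^o})
    (Delta : {ffun B -> k^o} -> {ffun B * B -> k^o})
    (eps : {ffun B -> k^o} -> k^o) : Prop :=
  exists S, hopf_quasigroup_axioms mul one Delta eps S.

Definition bc_basis (gT : finGroupType) (G M : {set gT}) : finType :=
  ({s : gT | s \in M} * {u : gT | u \in G})%type.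

(* The basis vector s (x) delta_u; it is only meaningful (and only used) for
   s in M and u in G. *)
Definition bc_vec (k : fieldType) (gT : finGroupType) (G M : {set gT})
    (s u : gT) : {ffun bc_basis G M -> k^o} :=
  [ffun p => ((val p.1 == s) && (val p.2 == u))%:R].

Definition bc_mul (k : fieldType) (gT : finGroupType) (G M : {set gT})
    (h h' : {ffun bc_basis G M -> k^o}) : {ffun bc_basis G M -> k^o} :=
  \sum_(p : bc_basis G M) \sum_(q : bc_basis G M)
    let: (s, u) := (val p.1, val p.2) in
    let: (t, v) := (val q.1, val q.2) in
    (h p * h' q) *: ((u == ltri G M t v)%:R *: bc_vec k G M (dot G M s t) v).

Definition bc_one (k : fieldType) (gT : finGroupType) (G M : {set gT}) :
    {ffun bc_basis G M -> k^o} :=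
  \sum_(u in G) bc_vec k G M 1%g u.

Definition bc_Delta (k : fieldType) (gT : finGroupType) (G M : {set gT})
    (h : {ffun bc_basis G M -> k^o}) :
    {ffun bc_basis G M * bc_basis G M -> k^o} :=
  \sum_(p : bc_basis G M)
    let: (s, u) := (val p.1, val p.2) in
    h p *: \sum_(a in G) \sum_(b in G | (a * b)%g == u)
      tens (bc_vec k G M s a) (bc_vec k G M (rtri G M s a) b).

Definition bc_eps (k : fieldType) (gT : finGroupType) (G M : {set gT})
    (h : {ffun bc_basis G M -> k^o}) : k^o :=
  \sum_(p : bc_basis G M) h p * (val p.2 == 1%g)%:R.

(* Main.v *)
(* Every element of X has the normal form (-1)^s g^b e^a with a, b in Z_2^3, so X
   is identified with a concrete group on triples (s, b, a), whose product has the
   sign of Cl_3 together with the pairing <a, b> coming from e_i g_i = - g_i e_i.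
   The element of M over a is (-1)^s g^q(a) e^a with q quadratic in a. As G
   multiplies normal forms on the left by translating b, factoring through G M
   replaces b by q(a): the product of M is the product of Cl_3 twisted by a cubic
   cochain, which is F, and M x G -> M is (s, a) <| b = (s + <a, b>, a), with
   trivial M x G -> G. The Hopf quasigroup axioms hold for every transversal M
   with trivial |> for which M has the inverse property, since then <| is a right
   action of G on M by automorphisms; the antipode sends s (x) delta_u to
   (s <| u)^-1 (x) delta_(u^-1). *)

Require Import Defs.
From HB Require Import structures.
From mathcomp Require Import all_boot all_algebra all_fingroup all_solvable.

Set Implicit Arguments.
Unset Strict Implicit.
Unset Printing Implicit Defensive.

Import GroupScope.

(** * Transversals and inverse property quasigroups *)

Section Transversal.

Variables (gT : finGroupType) (G : {group gT}) (M : {set gT}).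
Hypothesis trM : transversal_of G M.

(** [Gpart] picks some v in G with [v^-1 * (u * s)] in M. This element and s both represent the
    coset of [u * s], so uniqueness in the transversal forces v = u. *)
Lemma Gpart_mul u s : u \in G -> s \in M -> Gpart G M (u * s) = u.
Proof.
move=> Gu Ms; rewrite /Gpart; case: pickP => [v /andP[Gv Mv]|/(_ u)] /=; last first.
  by rewrite Gu mulKg Ms.
have [s0 [_ uniq_s0]] := trM (u * s).
have e1 : s0 = s by apply: uniq_s0; rewrite mem_rcoset mulgK.
have : s0 = v^-1 * (u * s).
  by apply: uniq_s0; split; rewrite // mem_rcoset invMg invgK mulKVg.
rewrite e1 mulgA -{1}[s]mul1g => /mulIg/(congr1 (mulg v)).
by rewrite mulKVg mulg1.
Qed.

Lemma Mpart_mul u s : u \in G -> s \in M -> Mpart G M (u * s) = s.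
Proof. by move=> Gu Ms; rewrite /Mpart Gpart_mul // mulKg. Qed.

Lemma Gpart_MpartP x :
  [/\ Gpart G M x \in G, Mpart G M x \in M & x = Gpart G M x * Mpart G M x].
Proof.
have [s [[Ms]]] := trM x; rewrite mem_rcoset => Gxs _.
by rewrite -[x in Gpart _ _ x](mulgKV s) -[x in Mpart _ _ x](mulgKV s)
  Gpart_mul // Mpart_mul // mulgKV.
Qed.

Lemma dot_closed s t : dot G M s t \in M.
Proof. by have [] := Gpart_MpartP (s * t). Qed.

Lemma rtri_closed s u : rtri G M s u \in M.
Proof. by have [] := Gpart_MpartP (s * u). Qed.

Hypothesis ltri_triv : {in M, forall s, {in G, forall u, ltri G M s u = u}}.

(** With trivial [ltri] the factorization of [s * u] has G-part u, so [rtri] is conjugation by u;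
    the action laws below come from associativity in the group. *)
Lemma mulg_rtri s u : s \in M -> u \in G -> s * u = u * rtri G M s u.
Proof. by move=> Ms Gu; rewrite /rtri /Mpart -/(ltri G M s u) ltri_triv // mulKVg. Qed.

Lemma rtri1 s : s \in M -> rtri G M s 1 = s.
Proof. by move=> Ms; rewrite -[RHS]mulg1 mulg_rtri ?mul1g. Qed.

Lemma rtri_mul s u v : s \in M -> u \in G -> v \in G ->
  rtri G M s (u * v) = rtri G M (rtri G M s u) v.
Proof.
move=> Ms Gu Gv; apply: (mulgI (u * v)); rewrite -mulg_rtri ?groupM //.
by rewrite -[RHS]mulgA -mulg_rtri ?rtri_closed // mulgA (mulg_rtri Ms Gu) -mulgA.
Qed.

Lemma rtri1l u : 1 \in M -> u \in G -> rtri G M 1 u = 1.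
Proof. by move=> M1 Gu; rewrite -[LHS](mulKg u) -mulg_rtri // mul1g mulVg. Qed.

(** Both sides are the M-part of [s * t * u]: u is moved left past the factored product of s and t,
    or past t and then s. *)
Lemma rtri_dot s t u : s \in M -> t \in M -> u \in G ->
  rtri G M (dot G M s t) u = dot G M (rtri G M s u) (rtri G M t u).
Proof.
move=> Ms Mt Gu.
have [Gst Mst Est] := Gpart_MpartP (s * t).
have [Gst' Mst' Est'] := Gpart_MpartP (rtri G M s u * rtri G M t u).
rewrite -[LHS](@Mpart_mul (Gpart G M (s * t) * u)) ?groupM ?rtri_closed //.
rewrite -[RHS](@Mpart_mul (u * Gpart G M (rtri G M s u * rtri G M t u))) ?groupM //.
congr Mpart; transitivity (s * t * u).
  by rewrite -mulgA -mulg_rtri // mulgA -[dot G M s t]/(Mpart G M (s * t)) -Est.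
rewrite -[LHS]mulgA (mulg_rtri Mt Gu) [LHS]mulgA (mulg_rtri Ms Gu).
by rewrite -[LHS]mulgA -[RHS]mulgA; congr (_ * _); apply: Est'.
Qed.

End Transversal.

(** * Inverses in an inverse property quasigroup *)

Section IPQuasigroup.

Variables (T : finType) (M : {set T}) (op : T -> T -> T) (e : T).
Hypothesis ipq : ip_quasigroup M op e.

(** [ipq_inv] only asserts existence; [pick] makes a function of it. The default s is never returned
    on M. *)
Definition ip_inv (s : T) : T :=
  odflt s [pick r in M | [forall t in M, (op r (op s t) == t) && (op (op t s) r == t)]].

Lemma ip_invP s : s \in M ->
  ip_inv s \in M /\
  {in M, forall t, op (ip_inv s) (op s t) = t /\ op (op t s) (ip_inv s) = t}.
Proof.
move=> Ms; rewrite /ip_inv; case: pickP => [r /andP[Mr /forall_inP rP]|no] /=.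
  by split=> // t /rP /andP[/eqP-> /eqP->].
have [r Mr rP] := ipq_inv ipq Ms; case/negP: (no r); rewrite Mr /=.
by apply/forall_inP => t /rP[-> ->]; rewrite !eqxx.
Qed.

Lemma ip_inv_closed s : s \in M -> ip_inv s \in M.
Proof. by case/ip_invP. Qed.

Lemma ip_invK s t : s \in M -> t \in M -> op (ip_inv s) (op s t) = t.
Proof. by case/ip_invP => _ sP /sP[]. Qed.

Lemma ip_invKr s t : s \in M -> t \in M -> op (op t s) (ip_inv s) = t.
Proof. by case/ip_invP => _ sP /sP[]. Qed.

Let ip_op s t : s \in M -> t \in M -> op s t \in M.
Proof. by move=> Ms Mt; apply: (ipq_closed ipq). Qed.

(* With r the inverse of s^-1, multiplication by r inverts multiplication by
   s^-1 as multiplication by s does, so r and s act alike. *)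
Lemma ip_invKV s t : s \in M -> t \in M -> op s (op (ip_inv s) t) = t.
Proof.
move=> Ms Mt; have Mi := ip_inv_closed Ms.
rewrite -[LHS](ip_invK Mi) ?ip_op //.
by rewrite (ip_invK Ms) ?ip_op // ip_invK.
Qed.

Lemma ip_invKVr s t : s \in M -> t \in M -> op (op t (ip_inv s)) s = t.
Proof.
move=> Ms Mt; have Mi := ip_inv_closed Ms.
rewrite -[LHS](ip_invKr Mi) ?ip_op //.
by rewrite (ip_invKr Ms) ?ip_op // ip_invKr.
Qed.

End IPQuasigroup.

(** * The normal form in X *)

Lemma ord3_ind (P : 'I_3 -> Prop) :
  P 0%R -> P 1%R -> P 2%:R%R -> forall i, P i.
Proof.
move=> P0 P1 P2 [[|[|[|i]]] lti] //.
- by rewrite (_ : Ordinal lti = 0%R) //; apply: val_inj.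
- by rewrite (_ : Ordinal lti = 1%R) //; apply: val_inj.
- by rewrite (_ : Ordinal lti = 2%:R%R) //; apply: val_inj.
Qed.

(** Booleans compute, unlike row vectors, so identities between exponents can be checked by running
    through all cases. *)
Notation bits := (bool * bool * bool)%type.

Definition bits_add (a b : bits) : bits :=
  let: (a1, a2, a3) := a in let: (b1, b2, b3) := b in
  (a1 (+) b1, a2 (+) b2, a3 (+) b3).

Definition bits_dot (a b : bits) : bool :=
  let: (a1, a2, a3) := a in let: (b1, b2, b3) := b in
  (a1 && b1) (+) (a2 && b2) (+) (a3 && b3).

(* The sign in e^a e^b = (-1)^(cliff a b) e^(a + b), where e^a stands for
   e_1^a_1 e_2^a_2 e_3^a_3. *)
Definition cliff (a b : bits) : bool :=
  let: (a1, a2, a3) := a in let: (b1, b2, b3) := b in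
  (a1 && b1) (+) (a2 && b2) (+) (a3 && b3)
  (+) (a2 && b1) (+) (a3 && b1) (+) (a3 && b2).

(* (s, b, a) stands for the normal form (-1)^s g^b e^a. *)
Definition Xmodel : Type := (bool * bits * bits)%type.

HB.instance Definition _ := Finite.on Xmodel.

Definition Xmodel_mul (x y : Xmodel) : Xmodel :=
  let: (s, b, a) := x in let: (t, d, c) := y in
  (s (+) t (+) bits_dot a d (+) cliff a c, bits_add b d, bits_add a c).

(** Exponents are their own opposites; the sign t solves $t + s + \langle a,b\rangle +
    \mathrm{cliff}(a,a) = 0$. *)
Definition Xmodel_inv (x : Xmodel) : Xmodel :=
  let: (s, b, a) := x in (s (+) bits_dot a b (+) cliff a a, b, a).

Lemma bits_addA : associative bits_add.
Proof. by move=> [[[] []] []] [[[] []] []] [[[] []] []]. Qed.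

Lemma bits_dotDl (a b c : bits) :
  bits_dot (bits_add a b) c = bits_dot a c (+) bits_dot b c.
Proof. by move: a b c => [[[] []] []] [[[] []] []] [[[] []] []]. Qed.

Lemma bits_dotDr (a b c : bits) :
  bits_dot a (bits_add b c) = bits_dot a b (+) bits_dot a c.
Proof. by move: a b c => [[[] []] []] [[[] []] []] [[[] []] []]. Qed.

Lemma cliffDl (a b c : bits) : cliff (bits_add a b) c = cliff a c (+) cliff b c.
Proof. by move: a b c => [[[] []] []] [[[] []] []] [[[] []] []]. Qed.

Lemma cliffDr (a b c : bits) : cliff a (bits_add b c) = cliff a b (+) cliff a c.
Proof. by move: a b c => [[[] []] []] [[[] []] []] [[[] []] []]. Qed.

(** Bilinear maps are 2-cocycles: once [bits_dot] and [cliff] are expanded, both sides carry the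
    same six terms besides the three signs. *)
Lemma Xmodel_mulA : associative Xmodel_mul.
Proof.
move=> [[s b] a] [[s' b'] a'] [[s'' b''] a''].
rewrite /Xmodel_mul !bits_addA bits_dotDl bits_dotDr cliffDl cliffDr.
congr (_, _, _).
move: (bits_dot a b') (bits_dot a b'') (bits_dot a' b'').
move: (cliff a a') (cliff a a'') (cliff a' a'').
by case: s; case: s'; case: s''; do 6!case.
Qed.

Lemma Xmodel_mul1 : left_id (false, (false, false, false), (false, false, false))
  Xmodel_mul.
Proof. by move=> [[[] [[[] []] []]] [[[] []] []]]. Qed.

Lemma Xmodel_mulV :
  left_inverse (false, (false, false, false), (false, false, false))
    Xmodel_inv Xmodel_mul.
Proof. by move=> [[[] [[[] []] []]] [[[] []] []]]. Qed.

HB.instance Definition _ :=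
  Finite_isGroup.Build Xmodel Xmodel_mulA Xmodel_mul1 Xmodel_mulV.

Definition Xmodel_z : Xmodel := (true, (false, false, false), (false, false, false)).
Definition unit_bits (i : 'I_3) : bits := (val i == 0, val i == 1, val i == 2)%N.
Definition Xmodel_e (i : 'I_3) : Xmodel := (false, (false, false, false), unit_bits i).
Definition Xmodel_g (i : 'I_3) : Xmodel := (false, unit_bits i, (false, false, false)).

Lemma Xmodel_relations : X_relations Xmodel_z Xmodel_e Xmodel_g.
Proof.
by split; try elim/ord3_ind; try elim/ord3_ind.
Qed.

Definition bits_prod (gT : groupType) (h : 'I_3 -> gT) (a : bits) : gT :=
  let: (a1, a2, a3) := a in h 0%R ^+ a1 * (h 1%R ^+ a2 * h 2%:R%R ^+ a3).

Definition Xval (gT : groupType) (z : gT) (e g : 'I_3 -> gT) (x : Xmodel) : gT :=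
  let: (s, b, a) := x in z ^+ s * (bits_prod g b * bits_prod e a).

(** * Evaluation of normal forms in a group satisfying the relations *)

Section Relations.

Variables (gT : groupType) (z : gT) (e g : 'I_3 -> gT).
Hypothesis rel : X_relations z e g.

Lemma expzD (s t : bool) : z ^+ s * z ^+ t = z ^+ (s (+) t).
Proof. by case: s t => [] []; rewrite ?expg1 ?mul1g ?mulg1 ?(X_zz rel). Qed.

Lemma ez_comm i (x s : bool) : e i ^+ x * z ^+ s = z ^+ s * e i ^+ x.
Proof. by case: x s => [] []; rewrite ?expg1 ?mul1g ?mulg1 ?(X_ze rel). Qed.

Lemma gz_comm i (x s : bool) : g i ^+ x * z ^+ s = z ^+ s * g i ^+ x.
Proof. by case: x s => [] []; rewrite ?expg1 ?mul1g ?mulg1 ?(X_zg rel). Qed.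

Lemma eg_comm i j (x y : bool) :
  e i ^+ x * g j ^+ y = z ^+ [&& x, y & i == j] * (g j ^+ y * e i ^+ x).
Proof.
case: x y => [] []; rewrite ?expg1 ?mul1g ?mulg1 //=.
have [->|ne_ij] := eqVneq i j; first by rewrite (X_eg_diag rel).
by rewrite mul1g (X_eg rel).
Qed.

Lemma gg_comm i j (x y : bool) : g i ^+ x * g j ^+ y = g j ^+ y * g i ^+ x.
Proof. by case: x y => [] []; rewrite ?expg1 ?mul1g ?mulg1 // (X_gg rel). Qed.

Lemma ggD i (x y : bool) : g i ^+ x * g i ^+ y = g i ^+ (x (+) y).
Proof. by case: x y => [] []; rewrite ?expg1 ?mul1g ?mulg1 // (X_g2 rel). Qed.

Lemma ee_comm i j (x y : bool) : i != j ->
  e i ^+ x * e j ^+ y = z ^+ (x && y) * (e j ^+ y * e i ^+ x).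
Proof.
by case: x y => [] []; rewrite ?expg1 ?mul1g ?mulg1 // => /(X_ee rel).
Qed.

Lemma eeD i (x y : bool) : e i ^+ x * e i ^+ y = z ^+ (x && y) * e i ^+ (x (+) y).
Proof. by case: x y => [] []; rewrite ?expg1 ?mul1g ?mulg1 // (X_e2 rel). Qed.

(** Lets a rule for [x * y] apply inside a right-associated word. *)
Let tail (x y w : gT) : x * y = w -> forall u, x * (y * u) = w * u.
Proof. by move=> E u; rewrite mulgA E. Qed.

(** Collection process: the relations, oriented as rewriting rules, bring z to the front, then the
    g's, then the e's, each with increasing index. *)
Lemma XvalM (x y : Xmodel) : Xval z e g x * Xval z e g y = Xval z e g (Xmodel_mul x y).
Proof.
pose zE := (expzD, fun s t => tail (expzD s t), ez_comm,
  fun i x s => tail (ez_comm i x s), gz_comm, fun i x s => tail (gz_comm i x s),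
  eg_comm, fun i j x y => tail (eg_comm i j x y)).
(* Only swaps that move a smaller index to the left are supplied, so the rewriting terminates. *)
pose gE := (ggD, fun i x y => tail (ggD i x y),
  gg_comm 1%R 0%R, fun x y => tail (gg_comm 1%R 0%R x y),
  gg_comm 2%:R%R 0%R, fun x y => tail (gg_comm 2%:R%R 0%R x y),
  gg_comm 2%:R%R 1%R, fun x y => tail (gg_comm 2%:R%R 1%R x y)).
have ne10 : 1%R != 0%R :> 'I_3 by [].
have ne20 : 2%:R%R != 0%R :> 'I_3 by [].
have ne21 : 2%:R%R != 1%R :> 'I_3 by [].
pose eE := (eeD, fun i x y => tail (eeD i x y),
  fun x y => ee_comm x y ne10, fun x y => tail (ee_comm x y ne10),
  fun x y => ee_comm x y ne20, fun x y => tail (ee_comm x y ne20),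
  fun x y => ee_comm x y ne21, fun x y => tail (ee_comm x y ne21)).
move: x y => [[s [[b1 b2] b3]] [[a1 a2] a3]] [[t [[d1 d2] d3]] [[c1 c2] c3]] /=.
rewrite -!mulgA; do !rewrite ?zE ?gE ?eE -?mulgA.
congr (z ^+ _ * _); rewrite /= ?andbT ?andbF ?addbF.
(* The nine conjunctions are the three terms of [bits_dot] and the six of [cliff]. *)
by case: s; case: t; do 9!case: (_ && _).
Qed.

Lemma Xval1 : Xval z e g 1 = 1.
Proof. by rewrite /= !mulg1. Qed.

Lemma Xval_z : Xval z e g Xmodel_z = z.
Proof. by rewrite /= !mulg1. Qed.

Lemma Xval_e i : Xval z e g (Xmodel_e i) = e i.
Proof. by elim/ord3_ind: i; rewrite /= !mul1g ?mulg1. Qed.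

Lemma Xval_g i : Xval z e g (Xmodel_g i) = g i.
Proof. by elim/ord3_ind: i; rewrite /= !mul1g ?mulg1. Qed.

End Relations.

Lemma morph_bits_prod (gT hT : groupType) (f : gT -> hT) (h : 'I_3 -> gT) a :
  {morph f : x y / x * y} -> f (bits_prod h a) = bits_prod (f \o h) a.
Proof.
move=> fM; have f1 : f 1 = 1 by apply: (mulgI (f 1)); rewrite -fM !mulg1.
have fX x (b : bool) : f (x ^+ b) = f x ^+ b by case: b.
by move: a => [[a1 a2] a3]; rewrite /= !fM !fX.
Qed.

Lemma morph_Xval (gT hT : groupType) (f : gT -> hT) z (e g : 'I_3 -> gT) x :
  {morph f : x y / x * y} ->
  f (Xval z e g x) = Xval (f z) (f \o e) (f \o g) x.
Proof.
move=> fM; have f1 : f 1 = 1 by apply: (mulgI (f 1)); rewrite -fM !mulg1.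
by move: x => [[[] b] a]; rewrite /= !fM ?f1 !(morph_bits_prod _ _ fM).
Qed.

Lemma eq_Xval (gT : groupType) z (e g e' g' : 'I_3 -> gT) :
  e =1 e' -> g =1 g' -> Xval z e g =1 Xval z e' g'.
Proof. by move=> Ee Eg [[s [[b1 b2] b3]] [[a1 a2] a3]]; rewrite /= !Ee !Eg. Qed.

Lemma Xval_model x : Xval Xmodel_z Xmodel_e Xmodel_g x = x.
Proof. by move: x => [[[] [[[] []] []]] [[[] []] []]]; vm_compute. Qed.

Definition X_gens (gT : finGroupType) (z : gT) (e g : 'I_3 -> gT) : {set gT} :=
  z |: [set e i | i : 'I_3] :|: [set g i | i : 'I_3].

Lemma mem_X_gens (gT : finGroupType) (z : gT) (e g : 'I_3 -> gT) :
  [/\ z \in X_gens z e g, forall i, e i \in X_gens z e g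
     & forall i, g i \in X_gens z e g].
Proof.
by split=> [|i|i]; rewrite !inE ?eqxx // imset_f ?orbT.
Qed.

Lemma bits_prod_in (gT : finGroupType) (h : 'I_3 -> gT) (H : {group gT}) a :
  (forall i, h i \in H) -> bits_prod h a \in H.
Proof. by move=> Hh; move: a => [[a1 a2] a3]; rewrite !groupM ?groupX. Qed.

Lemma Xval_in_gen (gT : finGroupType) (z : gT) (e g : 'I_3 -> gT) x :
  Xval z e g x \in <<X_gens z e g>>.
Proof.
have [Xz Xe Xg] := mem_X_gens z e g.
move: x => [[s b] a] /=.
by rewrite groupM ?groupX ?groupM ?bits_prod_in ?mem_gen // => i; rewrite mem_gen.
Qed.

(** Each triple is the value of its own normal form, which gives generation; the universal map is
    [Xval]. *)
Lemma Xmodel_presentation : X_presentation Xmodel_z Xmodel_e Xmodel_g.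
Proof.
split; first exact: Xmodel_relations.
- apply/eqP; rewrite eqEsubset subsetT; apply/subsetP => x _.
  by rewrite -[x]Xval_model Xval_in_gen.
- move=> hT z e g rel; exists (Xval z e g); split.
  + by move=> x y; rewrite (XvalM rel).
  + exact: Xval_z.
  + exact: Xval_e.
  + exact: Xval_g.
Qed.

(** * Boolean coordinates on Z_2^3 and the sign table *)

Definition bits_of (a : Z2_3) : bits :=
  (a ord0 0%R != 0%R, a ord0 1%R != 0%R, a ord0 2%:R%R != 0%R).

Definition of_bits (b : bits) : Z2_3 :=
  let: (b1, b2, b3) := b in
  (\row_j (nth false [:: b1; b2; b3] j)%:R)%R.

Lemma bits_ofK : cancel bits_of of_bits.
Proof.
have Z2E (x : 'Z_2) : ((x != 0)%:R)%R = x.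
  by apply: val_inj; case: x => [[|[|]]].
by move=> a; apply/rowP; elim/ord3_ind; rewrite mxE /= Z2E.
Qed.

Lemma of_bitsK : cancel of_bits bits_of.
Proof.
by move=> [[b1 b2] b3]; rewrite /bits_of !mxE; case: b1 b2 b3 => [] [] [].
Qed.

Lemma bits_ofD a b : bits_of (a + b)%R = bits_add (bits_of a) (bits_of b).
Proof.
have Z2D (x y : 'Z_2) : ((x + y)%R != 0%R) = ((x != 0%R) (+) (y != 0%R)).
  by move: x y => [[|[|]] // ?] [[|[|]] // ?].
by rewrite /bits_of !mxE !Z2D.
Qed.

Lemma binaryE a :
  binary a = let: (b1, b2, b3) := bits_of a in (4 * b1 + 2 * b2 + b3)%N.
Proof.
have Z2E (x : 'Z_2) : x = (x != 0%R) :> nat by case: x => [[|[|]]].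
by rewrite /binary 3!Z2E.
Qed.

(* e_a = (-1)^(Msign a) g^(Mbits a) e_1^a_1 e_2^a_2 e_3^a_3. *)
Definition Mbits (a : bits) : bits :=
  let: (a1, a2, a3) := a in (a2 && a3, a1 && a3, a1 && a2).

Definition Msign (a : bits) : bool :=
  let: (a1, a2, a3) := a in
  (a2 && a3) (+) (a1 && a3) (+) (a1 && a2) (+) [&& a1, a2 & a3].

Definition Melt (s : bool) (a : bits) : Xmodel := (s (+) Msign a, Mbits a, a).

(* F(a, b) = (-1)^(Fsign a b): the cochain of e_a e_b in X, with the factor
   coming from G discarded. *)
Definition Fsign (a b : bits) : bool :=
  Msign a (+) Msign b (+) Msign (bits_add a b) (+) bits_dot a (Mbits b)
  (+) cliff a b.

(** The only place where the table itself is consulted: its 64 entries are compared with [Fsign] by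
    evaluation. *)
Lemma F_Fsign a b : (F a b == -1)%R = Fsign (bits_of a) (bits_of b).
Proof.
rewrite /F !binaryE.
by move: (bits_of a) (bits_of b) => [[[] []] []] [[[] []] []].
Qed.

(** * Structure of an arbitrary group with the presentation *)

Section Presented.

Variables (gT : finGroupType) (z : gT) (e g : 'I_3 -> gT).
Hypothesis pres : X_presentation z e g.

Local Notation ev := (Xval z e g).

Lemma Xval_morphM x y : ev (x * y) = ev x * ev y.
Proof. by rewrite (XvalM (X_rel pres)). Qed.

(** The universal property gives a homomorphism back to the model that respects the generators;
    composed with evaluation it is the identity. *)
Lemma Xval_inj : injective ev.
Proof.
have [f [fM fz fe fg]] := X_univ pres Xmodel_relations.
apply: (can_inj (g := f)) => x.
by rewrite morph_Xval // fz (eq_Xval _ fe fg) Xval_model.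
Qed.

(** The values of normal forms are closed under products, hence form a subgroup, and it contains the
    generators. *)
Lemma Xval_surj x : exists y, x = ev y.
Proof.
have gV : group_set [set ev y | y : Xmodel].
  apply/group_setP; split; first by apply/imsetP; exists 1; rewrite ?Xval1.
  move=> _ _ /imsetP[x1 _ ->] /imsetP[x2 _ ->]; rewrite -Xval_morphM.
  exact: imset_f.
have : x \in <<X_gens z e g>> by rewrite (X_gen pres) inE.
suff /subsetP sub : <<X_gens z e g>> \subset Group gV.
  by move/sub => /imsetP[y _ ->]; exists y.
rewrite gen_subG; apply/subsetP => y; rewrite !inE.
case/orP=> [/orP[/eqP->|/imsetP[i _ ->]]|/imsetP[i _ ->]]; apply/imsetP.
- by exists Xmodel_z; rewrite ?Xval_z.
- by exists (Xmodel_e i); rewrite ?Xval_e.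
- by exists (Xmodel_g i); rewrite ?Xval_g.
Qed.

Definition gelt (b : bits) : Xmodel := (false, b, (false, false, false)).
Definition eelt (s : bool) (a : bits) : Xmodel := (s, (false, false, false), a).

Lemma Gsub_mem x : reflect (exists b, x = ev (gelt b)) (x \in Gsub g).
Proof.
apply: (iffP idP) => [|[b ->]]; last first.
  rewrite /= !mulg1 mul1g; apply: bits_prod_in => i.
  by rewrite mem_gen ?imset_f.
have gV : group_set [set ev (gelt b) | b : bits].
  apply/group_setP; split.
    by apply/imsetP; exists (false, false, false); rewrite ?Xval1.
  move=> _ _ /imsetP[b1 _ ->] /imsetP[b2 _ ->]; rewrite -Xval_morphM.
  apply/imsetP; exists (bits_add b1 b2) => //; congr ev.
  by move: b1 b2 => [[[] []] []] [[[] []] []].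
suff /subsetP sub : Gsub g \subset Group gV by move/sub => /imsetP[b _ ->]; exists b.
rewrite gen_subG; apply/subsetP => _ /imsetP[i _ ->]; apply/imsetP.
by exists (unit_bits i); rewrite // -(Xval_g z e).
Qed.

Lemma Cl3_mem x : reflect (exists s a, x = ev (eelt s a)) (x \in Cl3 z e).
Proof.
have Ce i : e i \in Cl3 z e by rewrite mem_gen // inE imset_f.
apply: (iffP idP) => [|[s [a ->]]]; last first.
  rewrite /= !mul1g groupM ?bits_prod_in ?groupX //.
  (* Both signs occur because z is the square of e_1. *)
  by rewrite -[X in X \in _](X_e2 (X_rel pres) 0%R) groupM.
have gV : group_set [set ev (eelt c.1 c.2) | c : bool * bits].
  apply/group_setP; split.
    by apply/imsetP; exists (false, (false, false, false)); rewrite ?Xval1.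
  move=> _ _ /imsetP[[s1 a1] _ ->] /imsetP[[s2 a2] _ ->]; rewrite -Xval_morphM.
  apply/imsetP; exists (s1 (+) s2 (+) cliff a1 a2, bits_add a1 a2) => //.
  congr ev => /=.
  by move: s1 s2 a1 a2 => [] [] [[[] []] []] [[[] []] []].
suff /subsetP sub : Cl3 z e \subset Group gV.
  by move/sub => /imsetP[[s a] _ ->]; exists s, a.
rewrite gen_subG; apply/subsetP => y /setUP[] /imsetP[i _ ->]; apply/imsetP.
  by exists (false, unit_bits i); rewrite // -(Xval_e z _ g).
exists (true, unit_bits i) => //.
by rewrite -{1}(Xval_z z e g) -{1}(Xval_e z e g i) -Xval_morphM.
Qed.

Lemma card_X : #|[set: gT]| = 128%N.
Proof.
have -> : [set: gT] = ev @: [set: Xmodel].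
  by apply/setP=> x; have [y ->] := Xval_surj x; rewrite inE imset_f.
rewrite card_imset ?cardsT; last exact: Xval_inj.
by transitivity #|{: bool * bits * bits}|; rewrite // !card_prod card_bool.
Qed.

(** If e_1 and g_1 commuted, their relation would give z = 1, against the injectivity of
    evaluation. *)
Lemma X_nonabelian : ~~ abelian [set: gT].
Proof.
apply/negP => /centsP/(_ (e 0%R) (in_setT _) (g 0%R) (in_setT _)) E.
have := X_eg_diag (X_rel pres) 0%R; rewrite E => /eqP.
rewrite eq_sym -[eqbRHS]mul1g => /eqP/mulIg.
by rewrite -(Xval_z z e g) -(Xval1 z e g) => /Xval_inj.
Qed.

Lemma card_Cl3 : #|Cl3 z e| = 16%N.
Proof.
have -> : Cl3 z e = [set ev (eelt c.1 c.2) | c : bool * bits] :> {set gT}.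
  apply/setP => x; apply/Cl3_mem/imsetP => [[s [a ->]]|[[s a] _ ->]].
    by exists (s, a).
  by exists s, a.
rewrite card_imset ?card_prod ?card_bool // => -[s a] [t b] /Xval_inj [-> ->] //.
Qed.

Lemma Cl3_sdprod : Cl3 z e ><| Gsub g = [set: gT].
Proof.
rewrite sdprodE.
- apply/setP => x; rewrite inE; have [[[s b] a] ->] := Xval_surj x.
  (* The term [bits_dot a b] cancels the sign produced by moving g^b to the left of e^a. *)
  apply/mulsgP; exists (ev (eelt (s (+) bits_dot a b) a)) (ev (gelt b)).
  + by apply/Cl3_mem; exists (s (+) bits_dot a b), a.
  + by apply/Gsub_mem; exists b.
  + rewrite -Xval_morphM; congr ev.
    by move: s a b => [] [[[] []] []] [[[] []] []].
- apply/subsetP => u /Gsub_mem [b ->]; rewrite inE; apply/subsetP => x.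
  rewrite mem_conjg => /Cl3_mem [s [a E]]; apply/Cl3_mem.
  exists (s (+) bits_dot a b), a; move/(canRL (conjgKV _)): E => ->.
  rewrite conjgE; apply: (mulgI (ev (gelt b))); rewrite mulgA mulgV mul1g.
  rewrite -!Xval_morphM; congr ev.
  by move: s a b => [] [[[] []] []] [[[] []] []].
- apply/trivgP/subsetP => x /setIP[/Cl3_mem[s [a ->]] /Gsub_mem[b /Xval_inj E]].
  by case: E => -> _ ->; rewrite inE Xval1.
Qed.

Lemma Gsub_isog : Gsub g \isog [set: 'rV['Z_2]_3].
Proof.
rewrite isog_sym; apply/isogP.
pose f (a : Z2_3) := ev (gelt (bits_of a)).
have fM : {in [set: Z2_3] &, {morph f : a b / a * b}}.
  by move=> a b _ _; rewrite /f -Xval_morphM [a * b]/(a + b)%R bits_ofD; congr ev.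
exists (Morphism fM) => /=.
  by apply/injmP=> a b _ _ /= /Xval_inj/(congr1 (fun x => x.1.2))/(can_inj bits_ofK).
apply/setP => x; rewrite morphimEdom; apply/imsetP/Gsub_mem => [[a _ ->]|[b ->]].
  by exists (bits_of a).
by exists (of_bits b); rewrite ?inE //= /f of_bitsK.
Qed.

(** * The transversal M and its induced maps *)

Local Notation G := (Gsub g).
Local Notation M := (Mset z e g).

(** Among the eight cases, [Msign] gives the minus signs at 011, 101 and 110; at 111 its four terms
    cancel. *)
Lemma signed_evecE x : signed_evec z e g x = ev (Melt x.1 (bits_of x.2)).
Proof.
rewrite /signed_evec /evec binaryE; move: x.1 (bits_of x.2) => s [[a1 a2] a3] /=.
rewrite -(expzD (X_rel pres)) -!mulgA; congr (_ * _).
by case: a1 a2 a3 => [] [] []; rewrite /= ?mul1g ?mulg1 ?mulgA.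
Qed.

Lemma Mset_mem x : reflect (exists s a, x = ev (Melt s a)) (x \in M).
Proof.
apply: (iffP imsetP) => [[[s a] _ ->]|[s [a ->]]].
  by exists s, (bits_of a); rewrite signed_evecE.
by exists (s, of_bits a); rewrite // signed_evecE of_bitsK.
Qed.

Lemma signed_evec_inj : injective (signed_evec z e g).
Proof.
move=> [s a] [t b]; rewrite !signed_evecE => /Xval_inj E.
have ab : a = b := can_inj bits_ofK (congr1 snd E).
by move: (congr1 (fun x => x.1.1) E) => /=; rewrite ab => /addIb ->.
Qed.

Lemma gelt_Melt b s a :
  gelt b * Melt s a = (s (+) Msign a, bits_add b (Mbits a), a) :> Xmodel.
Proof. by move: s a b => [] [[[] []] []] [[[] []] []]. Qed.

Lemma Xval_factor s b a :
  ev (s, b, a) = ev (gelt (bits_add b (Mbits a))) * ev (Melt (s (+) Msign a) a).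
Proof.
rewrite -Xval_morphM gelt_Melt addbK; congr ev.
by move: b a => [[[] []] []] [[[] []] []].
Qed.

(** Left multiplication by G changes only the exponent of g, so the sign and a single out one
    element of M in each coset. *)
Lemma Mset_transversal : transversal_of G M.
Proof.
move=> x; have [[[s b] a] ->] := Xval_surj x.
exists (ev (Melt (s (+) Msign a) a)); split; first split.
- by apply/Mset_mem; exists (s (+) Msign a), a.
- rewrite Xval_factor mem_rcoset mulgK; apply/Gsub_mem.
  by exists (bits_add b (Mbits a)).
- move=> _ [/Mset_mem[t [c ->]]].
  rewrite mem_rcoset => /Gsub_mem[d /(canRL (mulgKV _))].
  by rewrite -Xval_morphM gelt_Melt => /Xval_inj[-> _ ->]; rewrite addbK.
Qed.

(** The product split along G M: the G-factor is the coboundary of [Mbits] and gives [tau], while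
    the M-factor gives [dot] with sign [Fsign]. *)
Lemma Melt_mul s a t b :
  Melt s a * Melt t b =
  gelt (bits_add (bits_add (Mbits a) (Mbits b)) (Mbits (bits_add a b)))
  * Melt (s (+) t (+) Fsign a b) (bits_add a b) :> Xmodel.
Proof. by move: s t a b => [] [] [[[] []] []] [[[] []] []]. Qed.

Lemma Melt_gelt s a b :
  Melt s a * gelt b = gelt b * Melt (s (+) bits_dot a b) a :> Xmodel.
Proof. by move: s a b => [] [[[] []] []] [[[] []] []]. Qed.

Let gelt_in b : ev (gelt b) \in G.
Proof. by apply/Gsub_mem; exists b. Qed.

Let Melt_in s a : ev (Melt s a) \in M.
Proof. by apply/Mset_mem; exists s, a. Qed.

Lemma tau_Melt s a t b :
  tau G M (ev (Melt s a)) (ev (Melt t b)) =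
  ev (gelt (bits_add (bits_add (Mbits a) (Mbits b)) (Mbits (bits_add a b)))).
Proof.
by rewrite /tau -Xval_morphM Melt_mul Xval_morphM (Gpart_mul Mset_transversal).
Qed.

Lemma dot_Melt s a t b :
  dot G M (ev (Melt s a)) (ev (Melt t b)) =
  ev (Melt (s (+) t (+) Fsign a b) (bits_add a b)).
Proof.
by rewrite /dot -Xval_morphM Melt_mul Xval_morphM (Mpart_mul Mset_transversal).
Qed.

Lemma ltri_Melt s a b : ltri G M (ev (Melt s a)) (ev (gelt b)) = ev (gelt b).
Proof.
by rewrite /ltri -Xval_morphM Melt_gelt Xval_morphM (Gpart_mul Mset_transversal).
Qed.

Lemma rtri_Melt s a b :
  rtri G M (ev (Melt s a)) (ev (gelt b)) = ev (Melt (s (+) bits_dot a b) a).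
Proof.
by rewrite /rtri -Xval_morphM Melt_gelt Xval_morphM (Mpart_mul Mset_transversal).
Qed.

Lemma dot_octonion x y :
  dot G M (signed_evec z e g x) (signed_evec z e g y) =
  signed_evec z e g (octonion_mul x y).
Proof. by rewrite !signed_evecE dot_Melt -F_Fsign -bits_ofD. Qed.

Lemma Mset1 : 1 \in M.
Proof.
apply/Mset_mem; exists false, (false, false, false).
by rewrite -(Xval1 z e g).
Qed.

Lemma ltri_trivial : {in M, forall s, {in G, forall u, ltri G M s u = u}}.
Proof. by move=> _ /Mset_mem[s [a ->]] _ /Gsub_mem[b ->]; rewrite ltri_Melt. Qed.

Lemma Gsub_comm u v : u \in G -> v \in G -> u * v = v * u.
Proof.
move=> /Gsub_mem[b ->] /Gsub_mem[c ->]; rewrite -!Xval_morphM; congr ev.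
by move: b c => [[[] []] []] [[[] []] []].
Qed.

(** [rtri] changes only signs and [tau] does not see signs, so the left side is [tau G M s t];
    conjugation on the right is trivial as G is abelian. *)
Lemma tau_conj : {in M &, forall s t, {in G, forall u,
  tau G M (rtri G M s (ltri G M t u)) (rtri G M t u)
    = (ltri G M s (ltri G M t u))^-1 * tau G M s t * ltri G M s (ltri G M t u)}}.
Proof.
move=> _ _ /Mset_mem[s [a ->]] /Mset_mem[t [b ->]] _ /Gsub_mem[c ->].
by rewrite !ltri_Melt !rtri_Melt !tau_Melt -mulgA (@Gsub_comm _ (ev (gelt c))) // mulKg.
Qed.

Lemma Mset_ip_quasigroup : ip_quasigroup M (dot G M) 1.
Proof.
split.
- exact: Mset1.
- by move=> s t _ _; apply: (dot_closed Mset_transversal).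
- move=> s Ms; rewrite /dot -[1 * s]mulg1 -{1}[s]mul1g.
  by rewrite mulg1 (Mpart_mul Mset_transversal) // mul1g.
- by move=> s Ms; rewrite /dot mulg1 -[s]mul1g (Mpart_mul Mset_transversal) ?mul1g.
(* The inverse has the same index a, since a + a = 0, and its sign makes the product with the given
   element equal to 1. *)
- move=> _ /Mset_mem[s [a ->]]; exists (ev (Melt (s (+) Fsign a a) a)) => //.
  move=> _ /Mset_mem[t [b ->]]; rewrite !dot_Melt.
  by split; congr ev; move: s t a b => [] [] [[[] []] []] [[[] []] []].
Qed.

(** This is the right inverse property [op (op t s) r = t] at t = 1. *)
Lemma Mset_right_inverse : {in M, forall s, exists2 r, r \in M & dot G M s r = 1}.
Proof.
move=> s Ms; have [r Mr rP] := ipq_inv Mset_ip_quasigroup Ms; exists r => //.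
by have [_] := rP _ Mset1; rewrite (ipq_idl Mset_ip_quasigroup).
Qed.

End Presented.

(** * The bicrossproduct *)

Local Open Scope ring_scope.
Import GRing.Theory.

(** * Linear extension from a basis *)

Section LinearExtension.

Variables (k : fieldType) (B : finType) (W : lmodType k).
Implicit Types (h : {ffun B -> k^o}) (f : {ffun B -> k^o} -> W).

(** [tlift], [bc_Delta] and [bc_eps] are instances up to conversion and inherit linearity from
    it. *)
Definition linext (C : B -> W) h : W := \sum_p h p *: C p.

Lemma linext_linear C : linear (linext C).
Proof.
move=> a u v; rewrite /linext scaler_sumr -big_split /=; apply: eq_bigr => p _.
by rewrite !ffunE scalerDl scalerA.
Qed.

Lemma linext_delta C b : linext C (delta k b) = C b.
Proof.
rewrite /linext (bigD1 b) //= ffunE eqxx scale1r big1 ?addr0 // => c /negPf nc.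
by rewrite ffunE nc scale0r.
Qed.

Lemma linear_sum_fun (V : lmodType k) (f : V -> W) (I : Type) (r : seq I) (P : pred I)
    (F : I -> V) :
  linear f -> f (\sum_(i <- r | P i) F i) = \sum_(i <- r | P i) f (F i).
Proof.
(* Linearity is a hypothesis on a bare function; packing it gives access to the lemmas on bundled
   linear maps. *)
move=> lf; pose f' : {linear V -> W} := HB.pack f (GRing.isLinear.Build _ _ _ _ f lf).
exact: (linear_sum f').
Qed.

Lemma linear_scale_fun (V : lmodType k) (f : V -> W) a x :
  linear f -> f (a *: x) = a *: f x.
Proof.
move=> lf; pose f' : {linear V -> W} := HB.pack f (GRing.isLinear.Build _ _ _ _ f lf).
exact: (linearZ_LR f').
Qed.

Lemma linear_linext f : linear f -> f =1 linext (fun b => f (delta k b)).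
Proof.
move=> lf h; have {1}-> : h = \sum_p h p *: delta k p.
  apply/ffunP => c; rewrite sum_ffunE (bigD1 c) //= !ffunE eqxx big1 => [|d /negPf nd].
    by rewrite addr0 /GRing.scale /= mulr1.
  by rewrite !ffunE eq_sym nd scaler0.
by rewrite linear_sum_fun //; apply: eq_bigr => p _; rewrite linear_scale_fun.
Qed.

Lemma linear_eq_basis f f' : linear f -> linear f' ->
  (forall b, f (delta k b) = f' (delta k b)) -> f =1 f'.
Proof.
move=> lf lf' E h; rewrite (linear_linext lf) (linear_linext lf').
by apply: eq_bigr => b _; rewrite E.
Qed.

End LinearExtension.

Lemma comp_linear (k : fieldType) (U V W : lmodType k) (f : V -> W) (f' : U -> V) :
  linear f -> linear f' -> linear (fun x => f (f' x)).
Proof. by move=> lf lf' a x y; rewrite lf' lf. Qed.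

Lemma eval_linear (k : fieldType) (U : lmodType k) (A : finType)
    (f : U -> {ffun A -> k^o}) (a : A) :
  linear f -> linear (fun x => f x a : k^o).
Proof. by move=> lf c x y; rewrite lf !ffunE. Qed.

Lemma scale_linear (k : fieldType) (W : lmodType k) (c : k) :
  linear (fun x : W => c *: x).
Proof. by move=> a x y; rewrite scalerDr !scalerA mulrC. Qed.

Lemma scalel_linear (k : fieldType) (U W : lmodType k) (f : U -> k^o) (w : W) :
  linear f -> linear (fun x : U => f x *: w).
Proof. by move=> lf a x y; rewrite lf scalerDl scalerA. Qed.

(** * Tensor products of spaces with a basis *)

Section Tensor.

Variables (k : fieldType) (A B : finType).
Implicit Types (x : {ffun A -> k^o}) (y : {ffun B -> k^o}).

Lemma tens_linear_l y : linear (fun x => tens x y).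
Proof. by move=> a x x'; apply/ffunP => p; rewrite !ffunE /= mulrDl -mulrA. Qed.

Lemma tens_linear_r x : linear (fun y => tens x y).
Proof. by move=> a y y'; apply/ffunP => p; rewrite !ffunE /= mulrDr mulrCA. Qed.

Lemma tens_delta (p : A) (q : B) : tens (delta k p) (delta k q) = delta k (p, q).
Proof.
apply/ffunP => -[p' q']; rewrite !ffunE /= xpair_eqE.
by case: eqP; case: eqP; rewrite ?mulr1 ?mulr0.
Qed.

Variable W : lmodType k.
Implicit Type phi : {ffun A -> k^o} -> {ffun B -> k^o} -> W.

Lemma tlift_linear phi : linear (tlift phi).
Proof. exact: linext_linear. Qed.

Lemma tlift_delta phi p q :
  tlift phi (tens (delta k p) (delta k q)) = phi (delta k p) (delta k q).
Proof. by rewrite tens_delta [LHS]linext_delta. Qed.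

Lemma tlift_linear_fun (U : lmodType k)
    (phi : {ffun A -> k^o} -> {ffun B -> k^o} -> U -> W) t :
  (forall x y, linear (phi x y)) -> linear (fun u => tlift (fun x y => phi x y u) t).
Proof.
move=> lphi a u v; rewrite /tlift scaler_sumr -big_split; apply: eq_bigr => p _ /=.
by rewrite lphi scalerDr !scalerA mulrC.
Qed.

End Tensor.

(** * Hopf quasigroup axioms for a transversal with trivial left action *)

Section Bicrossproduct.

Variables (gT : finGroupType) (G : {group gT}) (M : {set gT}).
Hypotheses (trM : transversal_of G M)
  (ltri_triv : {in M, forall s, {in G, forall u, ltri G M s u = u}})
  (ipq : ip_quasigroup M (dot G M) 1%g).
Variable k : fieldType.

Local Notation H := {ffun bc_basis G M -> k^o}.
Local Notation bc := (bc_vec k G M).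
Local Notation act := (rtri G M).
Local Notation dotM := (dot G M).
Local Notation mulH := (@bc_mul k gT G M).
Local Notation DeltaH := (@bc_Delta k gT G M).
Local Notation epsH := (@bc_eps k gT G M).
Local Notation oneH := (bc_one k G M).
Local Notation inv := (ip_inv M dotM).

Definition bc_antipode (h : H) : H :=
  linext (fun p : bc_basis G M => bc (inv (act (val p.1) (val p.2))) (val p.2)^-1%g) h.

Lemma bc_vec_delta (p : bc_basis G M) : bc (val p.1) (val p.2) = delta k p.
Proof. by move: p => [p1 p2]; apply/ffunP => -[s u]; rewrite !ffunE. Qed.

Lemma bc_vecP s u : s \in M -> u \in G ->
  exists2 p : bc_basis G M, bc s u = delta k p & val p.1 = s /\ val p.2 = u.
Proof.
move=> Ms Gu; pose p : bc_basis G M := (exist _ s Ms, exist _ u Gu).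
by exists p; rewrite // -bc_vec_delta.
Qed.

Lemma linext_bc (W : lmodType k) (C : gT -> gT -> W) s u : s \in M -> u \in G ->
  linext (fun p : bc_basis G M => C (val p.1) (val p.2)) (bc s u) = C s u.
Proof. by move=> Ms Gu; have [p -> [<- <-]] := bc_vecP Ms Gu; rewrite linext_delta. Qed.

(** Reduces each multilinear axiom to vectors [bc s u] with s in M and u in G, one argument at a
    time. *)
Lemma bc_linear_eq (W : lmodType k) (f f' : H -> W) : linear f -> linear f' ->
  (forall s u, s \in M -> u \in G -> f (bc s u) = f' (bc s u)) -> f =1 f'.
Proof.
move=> lf lf' E; apply: linear_eq_basis => // p.
by rewrite -bc_vec_delta E ?(valP p.1) ?(valP p.2).
Qed.

Lemma tlift_bc (W : lmodType k) (phi : H -> H -> W) s u t v :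
  s \in M -> u \in G -> t \in M -> v \in G ->
  tlift phi (tens (bc s u) (bc t v)) = phi (bc s u) (bc t v).
Proof.
move=> Ms Gu Mt Gv; have [p -> _] := bc_vecP Ms Gu; have [q -> _] := bc_vecP Mt Gv.
exact: tlift_delta.
Qed.

Lemma bc_mul_linear_l g : linear (mulH^~ g).
Proof.
move=> a x y; rewrite /bc_mul scaler_sumr -big_split; apply: eq_bigr => p _ /=.
rewrite scaler_sumr -big_split; apply: eq_bigr => q _ /=.
by rewrite !ffunE !scalerA -!scalerDl mulrDl mulrA mulrDl.
Qed.

Lemma bc_mul_linear_r h : linear (mulH h).
Proof.
move=> a x y; rewrite /bc_mul scaler_sumr -big_split; apply: eq_bigr => p _ /=.
rewrite scaler_sumr -big_split; apply: eq_bigr => q _ /=.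
by rewrite !ffunE !scalerA -!scalerDl mulrDr mulrDl mulrCA mulrA.
Qed.

Lemma bc_mul_vec s u t v : s \in M -> u \in G -> t \in M -> v \in G ->
  mulH (bc s u) (bc t v) = (u == v)%:R *: bc (dotM s t) v.
Proof.
move=> Ms Gu Mt Gv; rewrite /bc_mul.
have [p -> [sE uE]] := bc_vecP Ms Gu; have [q -> [tE vE]] := bc_vecP Mt Gv.
rewrite (bigD1 p) //= (bigD1 q) //= !ffunE !eqxx mulr1 scale1r sE uE tE vE.
rewrite ltri_triv // !big1 ?addr0 // => [p' /negPf np|q' /negPf nq].
  by rewrite big1 // => q' _; rewrite ffunE np mul0r scale0r.
by rewrite [delta k q q']ffunE nq mulr0 scale0r.
Qed.

Lemma bc_Delta_linear : linear DeltaH.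
Proof. exact: linext_linear. Qed.

(** A factorization of u in G is determined by its first factor a. *)
Lemma bc_Delta_vec s u : s \in M -> u \in G ->
  DeltaH (bc s u) = \sum_(a in G) tens (bc s a) (bc (act s a) (a^-1 * u)%g).
Proof.
move=> Ms Gu; rewrite [LHS](linext_bc (fun s u => \sum_(a in G) \sum_(b in G | (a * b)%g == u)
      tens (bc s a) (bc (act s a) b))) //.
apply: eq_bigr => a Ga; rewrite (big_pred1 (a^-1 * u)%g) // => b /=.
apply/andP/eqP => [[_ /eqP <-]|->]; first by rewrite mulKg.
by rewrite mulKVg groupM ?groupV.
Qed.

Lemma bc_eps_linear : linear epsH.
Proof. exact: (linext_linear (fun p : bc_basis G M => (val p.2 == 1%g)%:R : k^o)). Qed.

Lemma bc_eps_vec s u : s \in M -> u \in G -> epsH (bc s u) = (u == 1%g)%:R.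
Proof. exact: (linext_bc (fun _ u => (u == 1%g)%:R : k^o)). Qed.

Lemma bc_antipode_linear : linear bc_antipode.
Proof. exact: linext_linear. Qed.

Lemma bc_antipode_vec s u : s \in M -> u \in G ->
  bc_antipode (bc s u) = bc (inv (act s u)) u^-1%g.
Proof. exact: (linext_bc (fun s u => bc (inv (act s u)) u^-1%g)). Qed.

Lemma tlift_Delta (W : lmodType k) (phi : H -> H -> W) s u : s \in M -> u \in G ->
  tlift phi (DeltaH (bc s u)) =
  \sum_(a in G) phi (bc s a) (bc (act s a) (a^-1 * u)%g).
Proof.
move=> Ms Gu; rewrite bc_Delta_vec // (linear_sum_fun _ _ _ (tlift_linear _)).
by apply: eq_bigr => a Ga; rewrite tlift_bc ?rtri_closed ?groupM ?groupV.
Qed.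

(** Used in both directions: to collapse a Kronecker delta, and to expand a single term into a sum
    that is then compared termwise. *)
Lemma sum_G_eq (W : lmodType k) (F : gT -> W) a : a \in G ->
  \sum_(b in G) (b == a)%:R *: F b = F a.
Proof.
move=> Ga; rewrite (bigD1 a) //= eqxx scale1r big1 ?addr0 // => b /andP[_ /negPf->].
by rewrite scale0r.
Qed.

Lemma sum_G_mul (W : lmodType k) (F : gT -> W) a : a \in G ->
  \sum_(b in G) F (a^-1 * b)%g = \sum_(b in G) F b.
Proof.
move=> Ga; rewrite (reindex_inj (mulgI a)) /=.
by apply: eq_big => b; rewrite ?groupMl // mulKg.
Qed.

Let M1 : 1%g \in M := ipq_id ipq.

Lemma bc_mul1l h : mulH oneH h = h.
Proof.
move: h; apply: (bc_linear_eq (bc_mul_linear_r _)) => // t v Mt Gv.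
rewrite (linear_sum_fun _ _ _ (bc_mul_linear_l _)).
rewrite -[in RHS](ipq_idl ipq Mt) -[RHS](sum_G_eq (fun v => bc (dotM 1 t) v) Gv).
apply: eq_bigr => u Gu; rewrite bc_mul_vec //.
by case: eqP => [->|]; rewrite ?scale0r.
Qed.

Lemma bc_mul1r h : mulH h oneH = h.
Proof.
move: h; apply: (bc_linear_eq (bc_mul_linear_l _)) => // s u Ms Gu.
rewrite (linear_sum_fun _ _ _ (bc_mul_linear_r _)).
rewrite -[RHS](sum_G_eq (bc s) Gu).
by apply: eq_bigr => v Gv; rewrite bc_mul_vec // (ipq_idr ipq) // eq_sym.
Qed.

Lemma bc_Delta1 : DeltaH oneH = tens oneH oneH.
Proof.
rewrite (linear_sum_fun _ _ _ bc_Delta_linear).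
rewrite (linear_sum_fun _ _ _ (tens_linear_l _)).
rewrite (eq_bigr _ (fun u Gu => bc_Delta_vec M1 Gu)) exchange_big /=.
apply: eq_bigr => a Ga; rewrite rtri1l //.
rewrite (sum_G_mul (fun b => tens (bc 1 a) (bc 1 b)) Ga).
by rewrite (linear_sum_fun _ _ _ (tens_linear_r _)).
Qed.

(** Multiplicativity rests on [rtri_dot]: G acts on M by automorphisms. *)
Lemma bc_DeltaM h g : DeltaH (mulH h g) = tmul mulH (DeltaH h) (DeltaH g).
Proof.
move: h; apply: bc_linear_eq.
- exact: (comp_linear bc_Delta_linear (bc_mul_linear_l g)).
- exact: (comp_linear (tlift_linear _) bc_Delta_linear).
move=> s u Ms Gu; move: g; apply: bc_linear_eq.
- exact: (comp_linear bc_Delta_linear (bc_mul_linear_r _)).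
- apply: tlift_linear_fun => x y.
  exact: (comp_linear (tlift_linear _) bc_Delta_linear).
move=> t v Mt Gv.
rewrite bc_mul_vec // linear_scale_fun; last exact: bc_Delta_linear.
rewrite bc_Delta_vec ?dot_closed // [RHS]tlift_Delta // scaler_sumr.
apply: eq_bigr => a Ga; rewrite tlift_Delta //.
(* The left side gets a delta forcing b = a, matching the vanishing of the other products on the
   right; the second delta, for [a^-1 * u] and [a^-1 * v], then reduces to u = v. *)
rewrite -[LHS](sum_G_eq (fun b => (u == v)%:R *:
  tens (bc (dotM s t) b) (bc (act (dotM s t) b) (b^-1 * v)%g)) Ga).
apply: eq_bigr => b Gb; rewrite bc_mul_vec //.
rewrite (linear_scale_fun _ _ (tens_linear_l _)) eq_sym.
have [->|] := eqVneq a b; last by rewrite !scale0r.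
rewrite bc_mul_vec ?rtri_closed ?groupM ?groupV // (inj_eq (mulgI _)).
by rewrite (linear_scale_fun _ _ (tens_linear_r _)) rtri_dot.
Qed.

(** Both sides sum over the splittings of u into y, [y^-1 * x] and [x^-1 * u]; the components in M
    agree because [rtri] is an action. *)
Lemma bc_coassoc h a b c :
  tlift (fun x y => tens (DeltaH x) y) (DeltaH h) ((a, b), c) =
  tlift (fun x y => tens x (DeltaH y)) (DeltaH h) (a, (b, c)).
Proof.
move: h; apply: (@bc_linear_eq k^o).
- apply: eval_linear; exact: (comp_linear (tlift_linear _) bc_Delta_linear).
- apply: eval_linear; exact: (comp_linear (tlift_linear _) bc_Delta_linear).
move=> s u Ms Gu; rewrite !tlift_Delta // !sum_ffunE.
transitivity (\sum_(x in G) \sum_(y in G) bc s y a * bc (act s y) (y^-1 * x)%g b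
   * bc (act s x) (x^-1 * u)%g c).
  apply: eq_bigr => x Gx; rewrite ffunE /= bc_Delta_vec // sum_ffunE mulr_suml.
  by apply: eq_bigr => y Gy; rewrite ffunE.
rewrite exchange_big /=; apply: eq_bigr => y Gy; rewrite [RHS]ffunE /=.
rewrite bc_Delta_vec ?rtri_closed ?groupM ?groupV // sum_ffunE mulr_sumr.
(* The inner sum is translated by y so that x denotes the product of the first two factors. *)
rewrite -[RHS](@sum_G_mul k^o _ _ Gy); apply: eq_bigr => x Gx.
rewrite [X in _ = _ * X]ffunE /= mulrA -rtri_mul ?groupM ?groupV //.
by rewrite mulKVg invMg invgK -!mulgA mulKVg.
Qed.

Lemma bc_counitl h : tlift (fun x y => epsH x *: y) (DeltaH h) = h.
Proof.
move: h; apply: bc_linear_eq => //.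
  exact: (comp_linear (tlift_linear _) bc_Delta_linear).
move=> s u Ms Gu; rewrite tlift_Delta //.
transitivity (\sum_(a in G) (a == 1%g)%:R *: bc (act s a) (a^-1 * u)%g).
  by apply: eq_bigr => a Ga; rewrite bc_eps_vec.
by rewrite sum_G_eq // rtri1 // invg1 mul1g.
Qed.

Lemma bc_counitr h : tlift (fun x y => epsH y *: x) (DeltaH h) = h.
Proof.
move: h; apply: bc_linear_eq => //.
  exact: (comp_linear (tlift_linear _) bc_Delta_linear).
move=> s u Ms Gu; rewrite tlift_Delta // -[RHS](sum_G_eq (bc s) Gu).
apply: eq_bigr => a Ga; rewrite bc_eps_vec ?rtri_closed ?groupM ?groupV //.
by rewrite -eq_mulVg1.
Qed.

Lemma bc_eps1 : epsH oneH = 1.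
Proof.
rewrite (linear_sum_fun _ _ _ bc_eps_linear).
rewrite -[RHS](@sum_G_eq k^o (fun => 1) 1%g) //.
by apply: eq_bigr => u Gu; rewrite bc_eps_vec // /GRing.scale /= mulr1.
Qed.

Lemma bc_epsM h g : epsH (mulH h g) = epsH h * epsH g.
Proof.
move: h; apply: (@bc_linear_eq k^o).
- exact: (comp_linear bc_eps_linear (bc_mul_linear_l g)).
- exact: (@scalel_linear k H k^o _ _ bc_eps_linear).
move=> s u Ms Gu; move: g; apply: (@bc_linear_eq k^o).
- exact: (comp_linear bc_eps_linear (bc_mul_linear_r _)).
- exact: (comp_linear (@scale_linear k k^o _) bc_eps_linear).
move=> t v Mt Gv; rewrite bc_mul_vec // (linear_scale_fun _ _ bc_eps_linear).
rewrite !bc_eps_vec ?dot_closed // /GRing.scale /=.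
by have [->|] := eqVneq v 1%g; rewrite ?mulr0 // !mulr1.
Qed.

(* In each antipode axiom on basis vectors, the sum over a reduces to a = w and
   is nonzero only for u = 1. *)
Lemma antipode_reduction (phi : H -> H -> H -> H) :
  (forall x y, linear (phi x y)) ->
  (forall s u t v, s \in M -> u \in G -> t \in M -> v \in G ->
     exists2 w, w \in G & forall a, a \in G ->
       phi (bc s a) (bc (act s a) (a^-1 * u)%g) (bc t v)
       = (a == w)%:R *: ((u == 1%g)%:R *: bc t v)) ->
  forall h g, tlift (fun x y => phi x y g) (DeltaH h) = epsH h *: g.
Proof.
move=> lphi phiE h g; move: h; apply: bc_linear_eq.
- exact: (comp_linear (tlift_linear _) bc_Delta_linear).
- exact: (scalel_linear _ bc_eps_linear).
move=> s u Ms Gu; move: g; apply: bc_linear_eq.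
- exact: tlift_linear_fun.
- exact: scale_linear.
move=> t v Mt Gv; have [w Gw wE] := phiE s u t v Ms Gu Mt Gv.
by rewrite tlift_Delta // (eq_bigr _ wE) sum_G_eq // bc_eps_vec.
Qed.

Let rM s u : act s u \in M.
Proof. exact: (rtri_closed trM). Qed.

Let dM s t : dotM s t \in M.
Proof. exact: (dot_closed trM). Qed.

Let iM s : s \in M -> inv s \in M.
Proof. exact: (ip_inv_closed ipq). Qed.

Let memE := (rM, dM, iM, groupV, groupM).

Lemma bc_antipode1 h g :
  tlift (fun x y => mulH (bc_antipode x) (mulH y g)) (DeltaH h) = epsH h *: g.
Proof.
apply: (antipode_reduction (phi := fun x y g => mulH (bc_antipode x) (mulH y g))).
  by move=> x y; apply: (comp_linear (bc_mul_linear_r _) (bc_mul_linear_r _)).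
(* The outer product requires [a^-1 = v], and then the inner one requires u = 1; the factors in M
   are [act s a] and its inverse, which cancel against t. *)
move=> s u t v Ms Gu Mt Gv; exists v^-1%g; rewrite ?groupV // => a Ga.
rewrite bc_antipode_vec // bc_mul_vec ?memE // (linear_scale_fun _ _ (bc_mul_linear_r _)).
rewrite bc_mul_vec ?memE // (ip_invK ipq) // -[a^-1%g == v](inj_eq invg_inj) invgK.
have [->|_] := eqVneq a v^-1%g; last by rewrite !scale0r scaler0.
by rewrite invgK -{2}[v]mulg1 (inj_eq (mulgI _)) !scale1r.
Qed.

Lemma bc_antipode2 h g :
  tlift (fun x y => mulH x (mulH (bc_antipode y) g)) (DeltaH h) = epsH h *: g.
Proof.
apply: (antipode_reduction (phi := fun x y g => mulH x (mulH (bc_antipode y) g))).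
  by move=> x y; apply: (comp_linear (bc_mul_linear_r _) (bc_mul_linear_r _)).
move=> s u t v Ms Gu Mt Gv; exists v => // a Ga.
(* The action law removes a from the antipode, leaving the inverse of [act s u], which is the
   inverse of s once u = 1. *)
rewrite bc_antipode_vec ?memE // -rtri_mul ?memE // mulKVg invMg invgK.
rewrite bc_mul_vec ?memE // (linear_scale_fun _ _ (bc_mul_linear_r _)).
rewrite bc_mul_vec ?memE //.
have [->|_] := eqVneq a v; last by rewrite !scale0r scaler0.
rewrite -{2}[v]mul1g (inj_eq (mulIg _)) !scale1r invg_eq1.
have [->|_] := eqVneq u 1%g; last by rewrite !scale0r.
by rewrite rtri1 // (ip_invKV ipq).
Qed.

Lemma bc_antipode3 h g :
  tlift (fun x y => mulH (mulH g (bc_antipode x)) y) (DeltaH h) = epsH h *: g.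
Proof.
apply: (antipode_reduction (phi := fun x y g => mulH (mulH g (bc_antipode x)) y)).
  by move=> x y; apply: (comp_linear (bc_mul_linear_l _) (bc_mul_linear_l _)).
(* Here the inner product, of g with the antipode, forces [a^-1 = v]. *)
move=> s u t v Ms Gu Mt Gv; exists v^-1%g; rewrite ?groupV // => a Ga.
rewrite bc_antipode_vec // bc_mul_vec ?memE // (linear_scale_fun _ _ (bc_mul_linear_l _)).
rewrite bc_mul_vec ?memE // (ip_invKVr ipq) // -[v == a^-1%g](inj_eq invg_inj) invgK eq_sym.
have [->|_] := eqVneq a v^-1%g; last by rewrite !scale0r.
rewrite invgK -{1}[v]mulg1 (inj_eq (mulgI _)) !scale1r eq_sym.
by have [->|_] := eqVneq u 1%g; rewrite ?mulg1 // !scale0r.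
Qed.

Lemma bc_antipode4 h g :
  tlift (fun x y => mulH (mulH g x) (bc_antipode y)) (DeltaH h) = epsH h *: g.
Proof.
apply: (antipode_reduction (phi := fun x y g => mulH (mulH g x) (bc_antipode y))).
  by move=> x y; apply: (comp_linear (bc_mul_linear_l _) (bc_mul_linear_l _)).
(* The inner product forces a = v; the outer one compares a with [u^-1 * a], so u = 1. *)
move=> s u t v Ms Gu Mt Gv; exists v => // a Ga.
rewrite bc_antipode_vec ?memE // -rtri_mul ?memE // mulKVg invMg invgK.
rewrite bc_mul_vec ?memE // (linear_scale_fun _ _ (bc_mul_linear_l _)).
rewrite bc_mul_vec ?memE // eq_sym.
have [->|_] := eqVneq a v; last by rewrite !scale0r.
rewrite -{1}[v]mul1g (inj_eq (mulIg _)) !scale1r eq_sym invg_eq1.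
have [->|_] := eqVneq u 1%g; last by rewrite !scale0r.
by rewrite rtri1 // invg1 mul1g (ip_invKr ipq).
Qed.

Lemma bicrossproduct_hopf_quasigroup : hopf_quasigroup mulH oneH DeltaH epsH.
Proof.
exists bc_antipode; split.
- exact: bc_mul_linear_l.
- exact: bc_mul_linear_r.
- exact: bc_mul1l.
- exact: bc_mul1r.
- exact: bc_Delta_linear.
- exact: bc_Delta1.
- exact: bc_DeltaM.
- exact: bc_eps_linear.
- exact: bc_eps1.
- exact: bc_epsM.
- exact: bc_coassoc.
- exact: bc_counitl.
- exact: bc_counitr.
- exact: bc_antipode_linear.
- exact: bc_antipode1.
- exact: bc_antipode2.
- exact: bc_antipode3.
- exact: bc_antipode4.
Qed.

End Bicrossproduct.

Local Close Scope ring_scope.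

(** * The octonion quasigroup as a transversal, and its bicrossproduct *)

Theorem mainTheorem2 :
  (exists (gT : finGroupType) (z : gT) (e g : 'I_3 -> gT),
     X_presentation z e g)
  /\
  forall (gT : finGroupType) (z : gT) (e g : 'I_3 -> gT),
    X_presentation z e g ->
    let G := Gsub g in
    let M := Mset z e g in
    [/\ [/\ #|[set: gT]| = 128%N, ~~ abelian [set: gT], #|Cl3 z e| = 16%N,
            G \isog [set: 'rV['Z_2]_3]
          & Cl3 z e ><| G = [set: gT]],
        [/\ 1 \in M, transversal_of G M, injective (signed_evec z e g)
          & forall x y : octonion,
              dot G M (signed_evec z e g x) (signed_evec z e g y)
                = signed_evec z e g (octonion_mul x y)],
        [/\ {in M, forall s, exists2 r, r \in M & dot G M s r = 1},
            ip_quasigroup M (dot G M) 1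
          & {in M &, forall s t, {in G, forall u,
              tau G M (rtri G M s (ltri G M t u)) (rtri G M t u)
                = (ltri G M s (ltri G M t u))^-1
                    * tau G M s t * ltri G M s (ltri G M t u)}}],
        {in M, forall s, {in G, forall u, ltri G M s u = u}}
      & forall k : fieldType,
          hopf_quasigroup (@bc_mul k gT G M) (bc_one k G M)
            (@bc_Delta k gT G M) (@bc_eps k gT G M)].
Proof.
split.
  (* The concrete model realizes the presentation, so the statement about all presented groups is
     not vacuous. *)
  by exists Xmodel, Xmodel_z, Xmodel_e, Xmodel_g; apply: Xmodel_presentation.
move=> gT z e g pres G M; split.
- split; [exact: card_X pres | exact: X_nonabelian pres | exact: card_Cl3 pres
    | exact: Gsub_isog pres | exact: Cl3_sdprod pres].
- split; [exact: Mset1 pres | exact: Mset_transversal pres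
    | exact: signed_evec_inj pres | exact: dot_octonion pres].
- split; [exact: Mset_right_inverse pres | exact: Mset_ip_quasigroup pres
    | exact: tau_conj pres].
- exact: ltri_trivial pres.
- move=> k; exact: (bicrossproduct_hopf_quasigroup (Mset_transversal pres)
    (ltri_trivial pres) (Mset_ip_quasigroup pres)).
Qed.
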